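(* If $G$ is an infinite non-abelian $\mathfrak{C}'$-cofinite group, then $G$ is not almost torsion-free. Moreover, if $G$ is also $\mathfrak{Z}_{mon}$-cofinite, then $G$ has a prime exponent $p\geq 5$.
   Context: For a group $G$ with neutral element $e$: $\mathfrak{C}'_G$ is the topology on $G$ having as a subbase of its closed sets all singletons together with all cosets $hC_G(g)$, $g,h\in G$, where $C_G(g)$ is the centralizer of $g$ in $G$; the monomial topology $\mathfrak{Z}_{mon,G}$ is the topology on $G$ having as a subbase of its closed sets all sets $\{x\in G: gx^n=e\}$ with $g\in G$, $n\in\mathbb{N}$. $G$ is $\mathfrak{C}'$-cofinite (resp. $\mathfrak{Z}_{mon}$-cofinite) if $\mathfrak{C}'_G$ (resp. $\mathfrak{Z}_{mon,G}$) is the cofinite topology on $G$ (closed sets: $G$ and the finite subsets of $G$). $G$ is almost torsion-free if $G[n]=\{g\in G: g^n=e\}$ is finite for every positive integer $n$. The exponent of $G$ is the smallest positive integer $m$ (if it exists) with $G[m]=G$. *)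

(* Defs.v *)
From HB Require Import structures.
From mathcomp Require Import all_boot.
From mathcomp Require Import boolp classical_sets cardinality.
From mathcomp Require Import topology_structure.

Set Implicit Arguments.
Unset Strict Implicit.
Unset Printing Implicit Defensive.

Local Open Scope classical_set_scope.
Local Open Scope group_scope.

(* The set T with the coarsest topology in which every member of S is closed:
   S is a subbase of closed sets, so the complements of its members form a
   subbase of open sets. *)
Definition closed_subbase_space (T : choiceType) (S : set (set T)) : Type := T.

HB.instance Definition _ (T : choiceType) (S : set (set T)) :=
  Choice.on (closed_subbase_space S).

HB.instance Definition _ (T : choiceType) (S : set (set T)) :=
  isSubBaseTopological.Build (closed_subbase_space S) S (@setC T).

Definition cofinite_topology (X : topologicalType) : Prop :=
  forall A : set X, closed A <-> A = setT \/ finite_set A.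

Section Groups.
Variable G : groupType.

Definition centralizer (g : G) : set G := [set x | commute x g].

Definition left_coset (h : G) (A : set G) : set G := [set h * x | x in A].

Definition Cprime_subbase : set (set G) :=
  [set A | (exists x, A = [set x]) \/
           (exists g h, A = left_coset h (centralizer g))].

(* n = 0 contributes only set0 and setT, which are closed in any topology, so
   it is immaterial whether 0 is allowed as an exponent. *)
Definition Zmon_subbase : set (set G) :=
  [set A | exists (g : G) (n : nat), A = [set x | g * x ^+ n = 1]].

Definition Cprime_topology : topologicalType :=
  closed_subbase_space Cprime_subbase.

Definition Zmon_topology : topologicalType :=
  closed_subbase_space Zmon_subbase.

Definition Cprime_cofinite : Prop := cofinite_topology Cprime_topology.

Definition Zmon_cofinite : Prop := cofinite_topology Zmon_topology.

Definition torsion_set (n : nat) : set G := [set g | g ^+ n = 1].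

Definition almost_torsion_free : Prop :=
  forall n : nat, (0 < n)%N -> finite_set (torsion_set n).

Definition abelian_group : Prop := forall x y : G, commute x y.

Definition has_exponent (m : nat) : Prop :=
  [/\ (0 < m)%N, torsion_set m = setT &
      forall k : nat, (0 < k)%N -> torsion_set k = setT -> (m <= k)%N].

End Groups.

(* Main.v *)
Require Import Defs.
From mathcomp Require Import all_boot.
From mathcomp Require Import classical_sets cardinality.
From mathcomp Require Import boolp filter topology_structure.

Local Open Scope classical_set_scope.

(** Let [g] be a non-central element.  Its centralizer is closed and proper,
hence finite.  As all powers of [g] lie in it, [g] has finite order [n > 0].
As conjugation by [x] determines the image of [g] only up to a coset of the
centralizer, the conjugacy class of [g] is infinite, and it consists of
solutions of [x ^+ n = 1].  This is the first claim.

For the second, cofiniteness of the monomial topology says that an equation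
[a * x ^+ n = 1] with infinitely many solutions holds identically.  By the
above, some equation [x ^+ n = 1] is of this kind, so [G] has an exponent [m].
If [m = a * b], the map [x |-> x ^+ a] takes its values in the solutions of
[y ^+ b = 1].  If [b < m] these are finitely many, so one fibre of the map is
infinite, hence is all of [G]; evaluating at 1 gives [x ^+ a = 1] identically,
so [a = m].  As [G] is non-trivial, [m] is prime ([exponent_prime]).

It remains to exclude 2 and 3.  A group of exponent 2 is abelian.  In a group of
exponent 3 every element commutes with its conjugates ([commute_conjg_exp3]),
so the infinite conjugacy class of [g] would lie in its finite centralizer. *)

Section Auxiliary.
Set Implicit Arguments.
Unset Strict Implicit.
Local Open Scope group_scope.

Lemma infinite_fibre (T U : Type) (f : T -> U) :
  infinite_set [set: T] -> finite_set (range f) ->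
  exists x, infinite_set [set y | f y = f x].
Proof.
move=> infT finf; apply: contrapT => /forallNP fin_fibre; apply: infT.
apply: (@sub_finite_set _ _ (\bigcup_(u in range f) [set y | f y = u])).
  by move=> x _; exists (f x) => //; exists x.
by apply: bigcup_finite => // _ [x _ <-]; apply: contrapT; apply: fin_fibre.
Qed.

Lemma closed_subbase (T : choiceType) (S : set (set T)) (A : set T) :
  S A -> closed (A : set (closed_subbase_space S)).
Proof.
move=> SA; rewrite -openC; exists [set ~` A]; last exact: bigcup_set1.
by move=> _ ->; apply: finI_from1.
Qed.

Lemma finite_centralizer (G : groupType) (g y : G) :
  Cprime_cofinite G -> ~ commute y g -> finite_set (centralizer g).
Proof.
move=> cofG ncyg.
have /cofG[cgT|//] : closed (centralizer g : set (Cprime_topology G)).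
  apply: closed_subbase; right; exists g, 1.
  by rewrite /left_coset (eq_imagel (f' := id)) ?image_id// => x _; rewrite mul1g.
by have : [set: G] y by []; rewrite -cgT.
Qed.

(** Each fibre of [x |-> g ^ x] is a right coset of the centralizer. *)
Lemma infinite_conjugates (G : groupType) (g : G) :
  infinite_set [set: G] -> finite_set (centralizer g) ->
  infinite_set (range (conjg g)).
Proof.
move=> infG fincg finJ; have [x] := infinite_fibre infG finJ; apply.
apply: (sub_finite_set _ (finite_image ( *%g^~ x) fincg)) => y gyx.
exists (y * x^-1); last by rewrite mulgVK.
by apply/esym; rewrite /commute conjgC conjgM gyx conjgK.
Qed.

(** Otherwise the powers of [g], which centralize [g], would be infinitely
many. *)
Lemma finite_centralizer_torsion (G : groupType) (g : G) :
  finite_set (centralizer g) -> exists2 n, (0 < n)%N & g ^+ n = 1.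
Proof.
move=> fincg; apply: contrapT => ntors; apply: infinite_nat.
apply: (sub_finite_set _ (finite_preimage (f := fun n => g ^+ n) _ fincg)).
  by move=> n _; apply/esym/commuteX.
suff lt_neq i j : (i < j)%N -> g ^+ i <> g ^+ j.
  by move=> i j _ _ gij; case: (ltngtP i j) => // /lt_neq; rewrite gij.
move=> ltij gij; apply: ntors; exists (j - i)%N; first by rewrite subn_gt0.
by rewrite expgnFr 1?ltnW// gij mulgV.
Qed.

(** The order of [g] is such an exponent: the conjugates of [g] satisfy the
same equation, and there are infinitely many of them. *)
Lemma infinite_torsion_set (G : groupType) (g : G) :
  infinite_set [set: G] -> finite_set (centralizer g) ->
  exists2 n, (0 < n)%N & infinite_set (@torsion_set G n).
Proof.
move=> infG fincg; have [n n0 gn1] := finite_centralizer_torsion fincg.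
exists n => // fint; apply: (infinite_conjugates infG fincg).
by apply: sub_finite_set fint => _ [x _ <-]; rewrite /torsion_set /= -conjXg gn1 conj1g.
Qed.

Lemma Zmon_infiniteT (G : groupType) (g : G) (n : nat) :
  Zmon_cofinite G -> infinite_set [set x : G | g * x ^+ n = 1] ->
  forall x, g * x ^+ n = 1.
Proof.
move=> cofG infS x.
have /cofG[ST|//] :
    closed ([set x : G | g * x ^+ n = 1] : set (Zmon_topology G)).
  by apply: closed_subbase; exists g, n.
by have : [set: G] x by []; rewrite -ST.
Qed.

Lemma has_exponent_exists (G : groupType) (n : nat) :
  (0 < n)%N -> torsion_set n = [set: G] -> exists m, has_exponent G m.
Proof.
move=> n0 tn; pose P k := `[< (0 < k)%N /\ torsion_set k = [set: G] >].
have exP : exists k, P k by exists n; apply/asboolP.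
case: (ex_minnP exP) => m /asboolP[m0 tm] minm.
by exists m; split=> // k k0 tk; apply: minm; apply/asboolP.
Qed.

(** If [m = a * b] with [1 < a < m], the map [x |-> x ^+ a] sends [G] into the
finite [b]-torsion, so it is constant on an infinite set, hence on [G] by
cofiniteness, which contradicts the minimality of [m]. *)
Lemma exponent_prime (G : groupType) (m : nat) :
  infinite_set [set: G] -> Zmon_cofinite G -> has_exponent G m -> prime m.
Proof.
move=> infG cofG [m0 tm minm].
have torsT n : infinite_set (@torsion_set G n) -> torsion_set n = [set: G].
  move=> inft; apply/seteqP; split=> // x _.
  rewrite /torsion_set /= -[LHS]mul1g; apply: Zmon_infiniteT => //.
  by under eq_set do rewrite mul1g.
apply: contrapT => /negP/primePn[m1|[a /andP[a1 am] /dvdnP[b mE]]].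
  apply: infG; rewrite -tm; have -> : m = 1%N by case: m m0 m1 {tm minm} => [|[]].
  by apply: (sub_finite_set _ (finite_set1 (1 : G))) => x; rewrite /torsion_set /= expg1.
have a0 : (0 < a)%N by apply: ltnW.
have b0 : (0 < b)%N by move: m0; rewrite mE muln_gt0 => /andP[].
have bm : (b < m)%N by rewrite mE ltn_Pmulr.
have fint k : (0 < k)%N -> (k < m)%N -> finite_set (@torsion_set G k).
  move=> k0 km; apply: contrapT => /torsT /(minm _ k0); by rewrite leqNgt km.
have finr : finite_set (range (fun x : G => x ^+ a)).
  apply: sub_finite_set (fint b b0 bm) => _ [x _ <-].
  have : [set: G] x by [].
  by rewrite -tm /torsion_set /= mE mulnC expgnA.
have [z infz] := infinite_fibre infG finr.
have eqz x : (z ^+ a)^-1 * x ^+ a = 1.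
  apply: Zmon_infiniteT => // finS; apply: infz; apply: sub_finite_set finS.
  by move=> y /= ->; rewrite mulVg.
have za1 : (z ^+ a)^-1 = 1 by have := eqz 1; rewrite expg1n mulg1.
have /(minm a a0) : torsion_set a = [set: G].
  by apply/seteqP; split=> // x _; have := eqz x; rewrite za1 mul1g.
by rewrite leqNgt am.
Qed.

(** Expanding [(x * y) ^+ 3 = 1] in terms of the conjugates of [x], with
[y ^+ 3 = 1], gives [x * x ^ y^-1 * x ^ y = 1]; doing it with [y^-1] in place
of [y] gives the same product with the last two factors exchanged. *)
Lemma commute_conjg_exp3 (G : groupType) (x y : G) :
  (forall z : G, z ^+ 3 = 1) -> commute x (x ^ y).
Proof.
move=> e3.
have prodJ u : x * x ^ u^-1 * x ^ u = 1.
  have uVV : u^-1 * u^-1 = u.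
    by rewrite -invgM; apply/mulg1_eq; rewrite -mulgA -expg2 -expgS.
  have := e3 (x * u); rewrite expgS expg2 => xu3; rewrite -[RHS]xu3.
  by rewrite !conjgE invgK !mulgA -[_ * u^-1 / u]mulgA uVV.
have eqJ : x ^ y^-1 * x ^ y = x ^ y * x ^ y^-1.
  apply: (mulgI x); have := prodJ y^-1.
  by rewrite invgK (mulgA x (x ^ y)) => ->; rewrite (mulgA x (x ^ y^-1)) prodJ.
have := prodJ y; rewrite -(mulgA x) => /mulg1_eq xV.
have cJ : commute (x ^ y) (x^-1) by rewrite xV; apply: commuteM.
by apply/commute_sym; rewrite -[X in commute _ X]invgK; apply: commuteV.
Qed.

Lemma infinite_class_not_commute (G : groupType) (g : G) :
  infinite_set [set: G] -> finite_set (centralizer g) ->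
  exists x, ~ commute g (g ^ x).
Proof.
move=> infG fincg; apply: contrapT => /forallNP cgJ.
apply: (infinite_conjugates infG fincg).
apply: sub_finite_set fincg => _ [x _ <-].
by apply/commute_sym; apply: contrapT; apply: cgJ.
Qed.

(** In exponent 2, [x * y] is its own inverse [y * x]. *)
Lemma commute_exp2 (G : groupType) (x y : G) :
  (forall z : G, z ^+ 2 = 1) -> commute x y.
Proof.
move=> e2; have invE (z : G) : z^-1 = z by apply: mulg1_eq; rewrite -expg2.
by rewrite /commute -[LHS]invE invgM !invE.
Qed.

End Auxiliary.

Theorem theorem5p9 (G : groupType) :
  infinite_set [set: G] -> ~ abelian_group G -> Cprime_cofinite G ->
  ~ almost_torsion_free G /\
  (Zmon_cofinite G ->
   exists p : nat, [/\ prime p, (5 <= p)%N & has_exponent G p]).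
Proof.
move=> infG nabG cofC.
have [g [y ncyg]] : exists g y : G, ~ commute y g.
  apply: contrapT => /forallNP nex; apply: nabG => x y.
  by move/forallNP: (nex y) => /(_ x)/contrapT.
have fincg := finite_centralizer cofC ncyg.
have [n n0 inft] := infinite_torsion_set infG fincg.
split=> [atf|cofZ]; first exact: inft (atf n n0).
have [m expm] : exists m, has_exponent G m.
  apply: (has_exponent_exists n0); apply/seteqP; split=> // x _.
  rewrite /torsion_set /= -[LHS]mul1g; apply: Zmon_infiniteT => //.
  by under eq_set do rewrite mul1g.
have pm := exponent_prime infG cofZ expm.
exists m; split=> //; case: expm => _ tm _.
have xm (x : G) : (x ^+ m = 1)%g by have : [set: G] x by []; rewrite -tm.
case: m pm xm {tm} => [|[|[|[|[|m]]]]] // _ xm.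
  by case: ncyg; apply: commute_exp2.
by have [x []] := infinite_class_not_commute infG fincg; apply: commute_conjg_exp3.
Qed.
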